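(* The competitive ratio of every deterministic algorithm for the online multiprocessor scheduling with testing problem on $m=2$ machines is greater than $2.2117$.
   Context: Online multiprocessor scheduling with testing on $m$ identical parallel machines: jobs $J_1,\dots,J_n$ arrive one by one in this order. When $J_j$ arrives, an upper bound $u_j\ge0$ and a testing time $t_j\ge0$ are revealed; its processing time $p_j\in[0,u_j]$ is unknown. Upon arrival the algorithm must irrevocably decide whether to test $J_j$ and on which machine to process it. An untested job occupies its machine for $u_j$ time; a tested job for $t_j+p_j$ time, $p_j$ being revealed after testing. The makespan $C^A(I)$ is the maximum machine load. With $\rho_j=\min\{u_j,t_j+p_j\}$, the optimal offline makespan $C^*(I)$ is the minimum over assignments of jobs to machines of the maximum over machines of the sum of $\rho_j$ of the jobs assigned to it. The competitive ratio of a deterministic algorithm $A$ is $\sup_I C^A(I)/C^*(I)$. *)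

(* Defs.v *)
From mathcomp Require Import all_boot all_order all_algebra.
From mathcomp Require Import all_classical all_reals ereal.

Set Implicit Arguments.
Unset Strict Implicit.
Unset Printing Implicit Defensive.

Import Order.TTheory GRing.Theory Num.Theory.

Local Open Scope classical_set_scope.
Local Open Scope ring_scope.

Section Jobs.
Variable R : realType.

Record job : Type := Job {
  upper_bound : R;
  testing_time : R;
  processing_time : R
}.

Definition valid_job (J : job) : Prop :=
  [/\ 0 <= upper_bound J, 0 <= testing_time J
    & 0 <= processing_time J <= upper_bound J].

(* Jobs are listed in order of arrival. *)
Definition instance : Type := seq job.

Definition valid_instance (I : instance) : Prop :=
  forall k, (k < size I)%N -> valid_job (nth (Job 0 0 0) I k).

(* The time a job occupies its machine, according to whether it is tested. *)
Definition duration (J : job) (tested : bool) : R :=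
  if tested then testing_time J + processing_time J else upper_bound J.

Definition rho (J : job) : R :=
  Num.min (upper_bound J) (testing_time J + processing_time J).

(* What is known of a job once it has been dealt with: (u, t, Some p) if it was
   tested and (u, t, None) otherwise, as p is revealed only by the test. *)
Definition observation : Type := (R * R * option R)%type.

Definition observe (J : job) (tested : bool) : observation :=
  (upper_bound J, testing_time J,
   if tested then Some (processing_time J) else None).

End Jobs.

Section Schedules.
Variables (R : realType) (m : nat).

(* A schedule lists, for each job, its duration and its machine. *)
Definition load (s : seq (R * 'I_m)) (i : 'I_m) : R :=
  \sum_(x <- s | x.2 == i) x.1.

(* Durations are nonnegative, so 0 is a harmless initial value. *)
Definition makespan (s : seq (R * 'I_m)) : R :=
  \big[Num.max/0]_(i < m) load s i.

(* A h u t is the decision (whether to test, which machine) for an arriving job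
   with upper bound u and testing time t, h being the observations of the
   earlier jobs in order of arrival. The earlier decisions need not be part of
   the input: they can be recomputed from h. The machine is chosen before the
   processing time of the arriving job is known, and neither the later jobs nor
   their number are available. *)
Definition algorithm : Type :=
  seq (observation R) -> R -> R -> bool * 'I_m.

Fixpoint run_from (A : algorithm) (h : seq (observation R)) (I : instance R) :
    seq (R * 'I_m) :=
  if I is J :: I' then
    let d := A h (upper_bound J) (testing_time J) in
    (duration J d.1, d.2) :: run_from A (rcons h (observe J d.1)) I'
  else [::].

Definition alg_makespan (A : algorithm) (I : instance R) : R :=
  makespan (run_from A [::] I).

(* The initial value of the minimum is the total duration, which is at least
   the makespan of every assignment. *)
Definition opt_makespan (I : instance R) : R :=
  \big[Num.min / \sum_(J <- I) rho J]_(a : (size I).-tuple 'I_m)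
    makespan (zip [seq rho J | J <- I] a).

(* The supremum is over the instances for which the ratio is defined, i.e.
   those with a nonzero optimum. *)
Definition competitive_ratio (A : algorithm) : \bar R :=
  ereal_sup [set (alg_makespan A I / opt_makespan I)%:E
            | I in [set I : instance R |
                    valid_instance I /\ 0 < opt_makespan I]].

End Schedules.

(* Main.v *)
Require Import Defs.
From mathcomp Require Import all_boot all_order all_algebra.
From mathcomp Require Import all_classical all_reals ereal.
From mathcomp Require Import lra.

Set Implicit Arguments.
Unset Strict Implicit.
Unset Printing Implicit Defensive.

Import Order.TTheory GRing.Theory Num.Theory.

Local Open Scope ring_scope.

(* The adversary sets p = u whenever a job with t <= u is tested, so that
   rho = u, and p = 0 whenever it is not, so that rho = t. With the first job
   (u, t) = (phi, 1), phi the golden ratio, the duration a of the job and its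
   rho b satisfy a >= phi b either way. The second job is (beta b, tau b); if it
   joins the first machine, that load already exceeds r times the optimum.
   Otherwise both loads are at least kappa S, where S is the sum of the two
   rho's, as soon as
     beta >= kappa (1 + tau),  phi >= kappa (1 + beta),
     tau + beta >= kappa (1 + beta).
   The third job is ((r - kappa) S, S): putting the first two jobs on one
   machine gives optimum at most S if it is untested, against a load of
   r S, and at most (r - kappa) S if it is tested, against a load of (r + 1) S.
   The latter ratio is at least r when kappa >= r - 1 - 1 / r. The constraints
   are tight for an r slightly above 2.2117, and r = 491 / 222 is a rational
   number of small height below that value. *)

Section Makespan.
Variables (R : realType) (m : nat).
Implicit Types (J : job R) (I : instance R) (s : seq (R * 'I_m)).

Lemma valid_instance_cons J I :
  valid_instance (J :: I) <-> valid_job J /\ valid_instance I.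
Proof.
split=> [JI_valid | [J_valid I_valid] [|k] //]; last exact: I_valid.
by split=> [|k]; [exact: (JI_valid 0) | exact: (JI_valid k.+1)].
Qed.

Lemma rho_ge0 J : valid_job J -> 0 <= rho J.
Proof. by case=> u_ge0 t_ge0 /andP[p_ge0 _]; rewrite le_min u_ge0 addr_ge0. Qed.

Lemma load_nil i : load ([::] : seq (R * 'I_m)) i = 0.
Proof. exact: big_nil. Qed.

Lemma load_cons x s i :
  load (x :: s) i = (if x.2 == i then x.1 else 0) + load s i.
Proof. by rewrite /load big_cons; case: ifP; rewrite ?add0r. Qed.

Lemma load_rho_ge0 I (a : seq 'I_m) i :
  valid_instance I -> 0 <= load (zip [seq rho J | J <- I] a) i.
Proof.
elim: I a => [|J I IH] [|k a] I_valid; rewrite /= ?load_nil //.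
have [J_valid {}I_valid] := (valid_instance_cons J I).1 I_valid.
by rewrite load_cons addr_ge0 ?IH //=; case: ifP; rewrite ?rho_ge0.
Qed.

Lemma load_le_makespan s i : load s i <= makespan s.
Proof. exact: le_bigmax. Qed.

Lemma makespan_le s (C : R) :
  0 <= C -> (forall i, load s i <= C) -> makespan s <= C.
Proof. by move=> C_ge0 load_le; exact: bigmax_le. Qed.

Lemma opt_makespan_le I (a : seq 'I_m) : size a = size I ->
  opt_makespan m I <= makespan (zip [seq rho J | J <- I] a).
Proof. move=> /eqP sz_a; exact: (bigmin_inf (Tuple sz_a)). Qed.

(** In any assignment, the machine that receives [J] has load at least [rho J]. *)
Lemma opt_makespan_gt0 J I :
  valid_instance (J :: I) -> 0 < rho J -> 0 < opt_makespan m (J :: I).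
Proof.
move=> JI_valid rho_gt0.
have [_ I_valid] := (valid_instance_cons J I).1 JI_valid.
apply: lt_bigmin => [|a _].
  rewrite big_cons ltr_wpDr //.
  elim: I {JI_valid} I_valid => [|K I IH] KI_valid; first by rewrite big_nil.
  have [K_valid I_valid] := (valid_instance_cons K I).1 KI_valid.
  by rewrite big_cons addr_ge0 ?rho_ge0 ?IH.
case/tupleP: a => i a; apply: lt_le_trans (load_le_makespan _ i).
by rewrite /= load_cons /= eqxx ltr_wpDr ?load_rho_ge0.
Qed.

(** An upper bound [C] on the optimum, from a single assignment, suffices; [0 < rho J] admits the
    instance to the supremum. *)
Lemma competitive_ratio_ge (A : algorithm R m) J I (r C : R) :
  valid_instance (J :: I) -> 0 < rho J -> 0 <= r ->
  opt_makespan m (J :: I) <= C -> r * C <= alg_makespan A (J :: I) ->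
  (r%:E <= competitive_ratio A)%E.
Proof.
move=> I_valid rho_gt0 r_ge0 opt_le alg_ge.
have opt_gt0 := opt_makespan_gt0 I_valid rho_gt0.
apply: (@le_trans _ _ (alg_makespan A (J :: I) / opt_makespan m (J :: I))%:E).
  rewrite lee_fin ler_pdivlMr //; apply: le_trans alg_ge.
  exact: ler_wpM2l.
by apply: ereal_sup_ubound; exists (J :: I).
Qed.

End Makespan.

Section Adversary.
Variable R : realType.
Implicit Types u t : R.

(** Letting the processing time depend on [tested] is fair: an algorithm decides from [u], [t] and
    the past alone. *)
Definition adversary_job u t (tested : bool) : job R :=
  Job u t (if tested then u else 0).

Lemma valid_adversary_job u t tested :
  0 <= u -> 0 <= t -> valid_job (adversary_job u t tested).
Proof. by move=> u_ge0 t_ge0; split=> //; case: tested; rewrite /= ?lexx ?u_ge0. Qed.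

Lemma duration_adversary_job u t tested :
  duration (adversary_job u t tested) tested = if tested then t + u else u.
Proof. by case: tested. Qed.

Lemma rho_adversary_job u t tested : 0 <= t <= u ->
  rho (adversary_job u t tested) = if tested then u else t.
Proof.
case/andP=> t_ge0 t_le_u; rewrite /rho; case: tested => /=.
  by rewrite min_l // lerDr.
by rewrite addr0 min_r.
Qed.

Lemma opt_makespan2_le (J1 J2 : job R) C :
  0 <= rho J1 <= C -> 0 <= rho J2 <= C -> opt_makespan 2 [:: J1; J2] <= C.
Proof.
move=> /andP[J1_ge0 J1_le] /andP[J2_ge0 J2_le].
apply: le_trans (@opt_makespan_le R 2 _ [:: ord0; ord_max] _) _ => //.
apply: makespan_le => [|[[|[|i]] //= ltI]]; first exact: le_trans J1_le.
  by rewrite !load_cons load_nil /= !(addr0, add0r).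
by rewrite !load_cons load_nil /= !(addr0, add0r).
Qed.

Lemma opt_makespan3_le (J1 J2 J3 : job R) C :
  0 <= C -> rho J1 + rho J2 <= C -> rho J3 <= C ->
  opt_makespan 2 [:: J1; J2; J3] <= C.
Proof.
move=> C_ge0 J12_le J3_le.
apply: le_trans (@opt_makespan_le R 2 _ [:: ord0; ord0; ord_max] _) _ => //.
apply: makespan_le => [//|[[|[|i]] //= ltI]].
  by rewrite !load_cons load_nil /= !(addr0, add0r).
by rewrite !load_cons load_nil /= !(addr0, add0r).
Qed.

End Adversary.

Theorem theorem6 (R : realType) (A : algorithm R 2) :
  ((22117 / 10000)%:E < competitive_ratio A)%E.
Proof.
pose r : R := 491 / 222; pose kappa : R := 357 / 470.
apply: (@lt_le_trans _ _ r%:E); first by rewrite lte_fin /r; lra.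
(* Consecutive Fibonacci numbers: x and (1 + x) / x = 2584 / 1597 surround phi. *)
pose x : R := 1597 / 987.
case def_d1: (A [::] x 1) => [e1 i1].
pose J1 := adversary_job x 1 e1.
pose a := if e1 then 1 + x else x; pose b := if e1 then x else 1.
have b_gt0 : 0 < b by rewrite /b /x; case: (e1); lra.
have ab : 2584 / 1597 * b <= a by rewrite /a /b /x; case: (e1); lra.
have rho1 : rho J1 = b.
  by apply: rho_adversary_job; rewrite /x; apply/andP; split; lra.
(* The factors are beta and tau: rationals meeting the three constraints with [kappa], and with 2584
   / 1597 for phi. *)
pose u2 := 191 / 169 * b; pose t2 := 121 / 248 * b.
case def_d2: (A [:: observe J1 e1] u2 t2) => [e2 i2].
pose J2 := adversary_job u2 t2 e2.
pose a2 := if e2 then t2 + u2 else u2; pose b2 := if e2 then u2 else t2.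
have rho2 : rho J2 = b2.
  by apply: rho_adversary_job; rewrite /u2 /t2; apply/andP; split; lra.
have J1_valid : valid_job J1 by apply: valid_adversary_job; rewrite /x; lra.
have J2_valid : valid_job J2 by apply: valid_adversary_job; rewrite /u2 /t2; lra.
have rho1_gt0 : 0 < rho J1 by rewrite rho1.
have r_ge0 : 0 <= r by rewrite /r; lra.
have [eq_i | neq_i] := eqVneq i1 i2.
  apply: (@competitive_ratio_ge R 2 A J1 [:: J2] r (Num.max b b2)) => //.
  - by rewrite !valid_instance_cons.
  - apply: opt_makespan2_le; rewrite ?rho1 ?rho2 le_max lexx ?orbT andbT.
      exact: ltW.
    by rewrite /b2 /u2 /t2; case: (e2); lra.
  - apply: le_trans (load_le_makespan _ i2).
    rewrite /= def_d1 /= def_d2 !load_cons load_nil /= eq_i eqxx addr0.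
    rewrite !duration_adversary_job -/a -/a2 maxr_pMr // ge_max.
    rewrite /a2 /b2 /u2 /t2 /r; case: (e2); apply/andP; split; lra.
pose S := b + b2; pose u3 := (r - kappa) * S.
case def_d3: (A [:: observe J1 e1; observe J2 e2] u3 S) => [e3 i3].
pose J3 := adversary_job u3 S e3.
have [S_gt0 a_ge a2_ge] : [/\ 0 < S, kappa * S <= a & kappa * S <= a2].
  by rewrite /a2 /S /b2 /kappa /u2 /t2; case: (e2); split; lra.
have S_u3 : S <= u3 by rewrite /u3 /r /kappa; lra.
pose b3 := if e3 then u3 else S.
have S_b3 : S <= b3 by rewrite /b3; case: (e3).
have rho3 : rho J3 = b3 by apply: rho_adversary_job; rewrite ltW.
apply: (@competitive_ratio_ge R 2 A J1 [:: J2; J3] r b3) => //.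
- rewrite !valid_instance_cons; split=> //; split=> //; split=> //.
  by apply: valid_adversary_job; lra.
- apply: opt_makespan3_le; rewrite ?rho1 ?rho2 ?rho3 //; lra.
- apply: le_trans (load_le_makespan _ i3).
  rewrite /= def_d1 /= def_d2 /= def_d3 !load_cons load_nil /= eqxx addr0.
  rewrite !duration_adversary_job -/a -/a2.
  (* [kappa * S] bounds from below the load of machine [i3] before the third job. *)
  apply: (@le_trans _ _ (kappa * S + if e3 then S + u3 else u3)).
    by rewrite /b3 /u3 /r /kappa; case: (e3); lra.
  rewrite addrA lerD2r.
  (* The disjunction below leaves open that both equalities hold; the sign settles that case. *)
  have kS_ge0 : 0 <= kappa * S by apply: mulr_ge0; rewrite /kappa; lra.
  have : (i1 == i3) || (i2 == i3).
    by case: (i1) (i2) (i3) neq_i => [[|[|?]] ?] [[|[|?]] ?] [[|[|?]] ?] //.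
  by case: eqP; case: eqP => //= *; lra.
Qed.
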